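(* Let $P=x\frac{d}{dx}x\frac{d}{dy}$ on $\mathbb{C}\langle x,y\rangle$. For $f\in\mathbb{C}\langle x,y\rangle$ we have, in $T/[T,T]$, $$d_P(f)=\left(x\frac{df}{dy}''\frac{df}{dy}'x\right)\frac{d}{dx}-\left(x\frac{df}{dx}''\frac{df}{dx}'x\right)\frac{d}{dy}.$$ Consequently $$H^0_P(\mathbb{C}\langle x,y\rangle)=\mathbb{C}.$$
   Context: $\mathbb{C}$ is an algebraically closed field of characteristic $0$. Let $A=\mathbb{C}\langle x,y\rangle$. $\frac{d}{dx},\frac{d}{dy}:A\to A\otimes A$ are the derivations for the outer bimodule structure $a(a'\otimes a'')b=aa'\otimes a''b$ with $\frac{d}{dx}(x)=1\otimes1$, $\frac{d}{dx}(y)=0$, $\frac{d}{dy}(y)=1\otimes1$, $\frac{d}{dy}(x)=0$; Sweedler notation: $\frac{df}{dx}=\frac{df}{dx}'\otimes\frac{df}{dx}''$ (summation understood), similarly for $y$. $T=T_A$, the tensor algebra of the $A$-bimodule of double derivations $\mathrm{Der}(A,A\otimes A)$, is the free algebra on $x,y,\frac{d}{dx},\frac{d}{dy}$, graded with $|x|=|y|=0$ and $|\frac{d}{dx}|=|\frac{d}{dy}|=1$. $[T,T]$ is the span of supercommutators $uv-(-1)^{|u||v|}vu$. The double Schouten bracket is the unique bilinear $\{\!\!\{-,-\}\!\!\}:T\otimes T\to T\otimes T$ vanishing on pairs from $\{x,y\}$ and on pairs from $\{\frac d{dx},\frac d{dy}\}$, with $\{\!\!\{\delta,a\}\!\!\}=\delta(a)$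 for $\delta\in\{\frac d{dx},\frac d{dy}\}$, $a\in\{x,y\}$, and, for homogeneous $u,v,w$, $\{\!\!\{u,vw\}\!\!\}=(-1)^{(|u|-1)|v|}v\{\!\!\{u,w\}\!\!\}+\{\!\!\{u,v\}\!\!\}w$, $\{\!\!\{u,v\}\!\!\}=-(-1)^{(|u|-1)(|v|-1)}\sigma\{\!\!\{v,u\}\!\!\}$, $\sigma(a\otimes b)=(-1)^{|a||b|}b\otimes a$. Then $\{-,-\}=\mu\circ\{\!\!\{-,-\}\!\!\}$ ($\mu$ the multiplication) induces a bracket on $T/[T,T]$. For a double Poisson tensor $P$ (degree $2$ with $\{P,P\}=0$ in $T/[T,T]$; the given $P$ is one) the map $d_P=\{P,-\}$ is a differential of degree $+1$ on $T/[T,T]$, and $H^i_P(A)$ is the cohomology at $(T/[T,T])_i$; in particular $H^0_P(A)=\ker(d_P:A/[A,A]\to(T/[T,T])_1)$. *)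

(* Defs.v *)
(* MathComp; free algebras are monoid algebras of free monoids (multinomials),
   and classical logic (boolp) decides membership in [T, T]. *)
From HB Require Import structures.
From mathcomp Require Import all_boot all_order all_algebra ring_quotient.
From mathcomp Require Import finmap.
From mathcomp Require Import boolp.
From mathcomp Require Import monalg.

Set Implicit Arguments.
Unset Strict Implicit.
Unset Printing Implicit Defensive.

Import GRing.Theory.
Local Open Scope ring_scope.
Local Open Scope quotient_scope.

Section LinearExtension.
Context {K : fieldType}.

Definition lext {M : choiceType} {V : lmodType K} (f : M -> V)
    (g : {malg K[M]}) : V :=
  \sum_(k <- msupp g) g@_k *: f k.

Definition bilext {M N : choiceType} {V : lmodType K} (f : M -> N -> V)
    (g : {malg K[M]}) (h : {malg K[N]}) : V :=
  lext (fun m => lext (f m) h) g.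

Section Theory.
Context {M : choiceType} {V : lmodType K}.
Implicit Types (f : M -> V) (g : {malg K[M]}).

Lemma lextEw f (d : {fset M}) g : (msupp g `<=` d)%fset ->
  lext f g = \sum_(k <- d) g@_k *: f k.
Proof.
move=> le; rewrite [LHS](big_fset_incl _ le) => //= x xd /mcoeff_outdom ->.
by rewrite scale0r.
Qed.

Lemma lext_linear f : linear (lext f).
Proof.
move=> c g1 g2; pose d := (msupp g1 `|` msupp g2)%fset.
have l1 : (msupp g1 `<=` d)%fset by apply: fsubsetUl.
have l2 : (msupp g2 `<=` d)%fset by apply: fsubsetUr.
have l3 : (msupp (c *: g1 + g2) `<=` d)%fset.
  apply: fsubset_trans (msuppD_le _ _) _.
  by apply: fsetSU; apply: msuppZ_le.
rewrite !(@lextEw f d) // scaler_sumr -big_split; apply: eq_bigr => k _ /=.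
by rewrite mcoeffD mcoeffZ scalerDl scalerA.
Qed.

Lemma lextU f k : lext f << k >> = f k.
Proof. by rewrite /lext msuppU oner_eq0 big_seq_fset1 mcoeffUU scale1r. Qed.

Lemma lext_eq f1 f2 g : (forall k, f1 k = f2 k) -> lext f1 g = lext f2 g.
Proof. by move=> e; apply: eq_bigr => k _; rewrite e. Qed.

Lemma lin_sum (phi : {malg K[M]} -> V) g : linear phi ->
  phi g = \sum_(k <- msupp g) g@_k *: phi << k >>.
Proof.
move=> lin; have phi0 : phi 0 = 0.
  have := lin (-1) 0 0; rewrite scaler0 addr0 => ->.
  by rewrite scaleN1r addNr.
rewrite {1}[g]monalgE.
elim: (msupp g : seq M) => [|k s IH]; first by rewrite !big_nil phi0.
rewrite !big_cons -IH -lin; congr (phi (_ + _)).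
by apply/malgP => k'; rewrite mcoeffZ !mcoeffU mulr_natr.
Qed.

Lemma lin_eq_in (phi psi : {malg K[M]} -> V) g : linear phi -> linear psi ->
  (forall k, k \in msupp g -> phi << k >> = psi << k >>) -> phi g = psi g.
Proof.
move=> l1 l2 e; rewrite (lin_sum g l1) (lin_sum g l2).
by apply: eq_big_seq => k kg; rewrite e.
Qed.

Lemma lin_eq (phi psi : {malg K[M]} -> V) : linear phi -> linear psi ->
  (forall k, phi << k >> = psi << k >>) -> phi =1 psi.
Proof. by move=> l1 l2 e g; apply: lin_eq_in. Qed.

End Theory.

Section BilTheory.
Context {M N : choiceType} {V : lmodType K}.
Implicit Types (g : {malg K[M]}) (h : {malg K[N]}).

Lemma bilext_linl (f : M -> N -> V) h : linear (fun g => bilext f g h).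
Proof. exact: lext_linear. Qed.

Lemma bilext_linr (f : M -> N -> V) g : linear (bilext f g).
Proof.
have E h : bilext f g h = \sum_(k <- msupp g) g@_k *: lext (f k) h by [].
move=> c h1 h2; rewrite !E scaler_sumr -big_split.
apply: eq_bigr => k _ /=.
by rewrite (lext_linear (f k)) scalerDr !scalerA mulrC.
Qed.

Lemma bilextU (f : M -> N -> V) m n : bilext f << m >> << n >> = f m n.
Proof. by rewrite /bilext !lextU. Qed.

End BilTheory.
End LinearExtension.

Lemma lin_comp (K : fieldType) (U V W : lmodType K) (f : U -> V) (g : V -> W) :
  linear f -> linear g -> linear (fun u => g (f u)).
Proof. by move=> lf lg c x y; rewrite lf lg. Qed.

Lemma lin_add (K : fieldType) (U V : lmodType K) (f g : U -> V) :
  linear f -> linear g -> linear (fun u => f u + g u).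
Proof. by move=> lf lg c x y; rewrite lf lg scalerDr addrACA. Qed.

Lemma lin_scale (K : fieldType) (U V : lmodType K) (a : K) (f : U -> V) :
  linear f -> linear (fun u => a *: f u).
Proof. by move=> lf c x y; rewrite lf scalerDr !scalerA mulrC. Qed.

Lemma lin_sub (K : fieldType) (U V : lmodType K) (f g : U -> V) :
  linear f -> linear g -> linear (fun u => f u - g u).
Proof.
by move=> lf lg c x y; rewrite lf lg scalerBr opprD addrACA.
Qed.

Lemma lin_mulr (K : fieldType) (M : monomType) (v : {malg K[M]}) :
  linear (fun w : {malg K[M]} => v * w).
Proof.
suff -> : (fun w => v * w) = bilext (fun m n : M => << (mmul m n) >>) v.
  exact: bilext_linr.
apply/funext => w; rewrite /bilext /lext malgME; apply: eq_bigr => k1 _.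
rewrite scaler_sumr; apply: eq_bigr => k2 _; apply/malgP => k.
by rewrite !mcoeffZ !mcoeffU mulrA mulr_natr.
Qed.

Lemma lin_mull (K : fieldType) (M : monomType) (v : {malg K[M]}) :
  linear (fun w : {malg K[M]} => w * v).
Proof. by move=> c x y; rewrite mulrDl scalerAl. Qed.

Notation freealg K I := {malg K[{fmonom I}]}.

(* F ⊗ F for the free algebra F, as the space with basis the pairs (u, v) of
   words; the pair (u, v) is the tensor u ⊗ v. *)
Notation freealg2 K I := {malg K[({fmonom I} * {fmonom I})%type]}.

Definition gen (K : fieldType) (I : choiceType) (i : I) : freealg K I :=
  << fmu i >>.
Arguments gen K {I} i.

Section Tensor.
Context {K : fieldType} {I : choiceType}.
Local Notation F := (freealg K I).
Local Notation FF := (freealg2 K I).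

Definition tens : F -> F -> FF := bilext (fun u v => << (u, v) >>).

(* a (a' ⊗ a'') = a a' ⊗ a'' and (a' ⊗ a'') b = a' ⊗ a'' b *)
Definition outl : F -> FF -> FF :=
  bilext (fun w p => << (mmul w p.1, p.2) >>).
Definition outr : FF -> F -> FF :=
  bilext (fun p w => << (p.1, mmul p.2 w) >>).

(* a' ⊗ a'' |-> a' a'' and a' ⊗ a'' |-> a'' a' *)
Definition mu : FF -> F := lext (fun p => << mmul p.1 p.2 >>).
Definition mu_op : FF -> F := lext (fun p => << mmul p.2 p.1 >>).

End Tensor.

Section Graded.
Context {K : fieldType} {I : choiceType} (deg : I -> nat).
Local Notation F := (freealg K I).
Local Notation FF := (freealg2 K I).

Definition wdeg (w : {fmonom I}) : nat := \sum_(i <- (w : seq I)) deg i.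

Definition homog (n : nat) (u : F) : Prop :=
  forall w, w \in msupp u -> wdeg w = n.

(* σ(a ⊗ b) = (-1)^(|a||b|) b ⊗ a *)
Definition flip : FF -> FF :=
  lext (fun p => (-1) ^+ (wdeg p.1 * wdeg p.2) *: << (p.2, p.1) >>).

(* [F, F], the span of the supercommutators of homogeneous elements *)
Inductive scomm : F -> Prop :=
| scomm0 : scomm 0
| scomm_cons c m n u v s : homog m u -> homog n v -> scomm s ->
    scomm (c *: (u * v - (-1) ^+ (m * n) *: (v * u)) + s).

Lemma scommD s t : scomm s -> scomm t -> scomm (s + t).
Proof.
by elim=> [|c m n u v r hu hv _ IH] ht; rewrite ?add0r // -addrA; constructor; auto.
Qed.

Lemma scommZ a s : scomm s -> scomm (a *: s).
Proof.
elim=> [|c m n u v r hu hv _ IH]; first by rewrite scaler0; constructor.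
by rewrite scalerDr scalerA; constructor.
Qed.

Definition scommb : pred F := fun u => `[< scomm u >].

Lemma scommb_zmod : zmod_closed scommb.
Proof.
split; first exact/asboolP/scomm0.
move=> x y /asboolP hx /asboolP hy; apply/asboolP; apply: scommD => //.
by rewrite -scaleN1r; apply: scommZ.
Qed.

HB.instance Definition _ := GRing.isZmodClosed.Build F scommb scommb_zmod.

Definition scomm_closed : zmodClosed F := GRing.ZmodClosed.clone F scommb _.

(* F / [F, F] *)
Definition cyc := Quotient.quot scomm_closed.
HB.instance Definition _ := Choice.on cyc.
HB.instance Definition _ := GRing.Zmodule.on cyc.

Definition cls (u : F) : cyc := \pi_(Quotient.quot scomm_closed) u.
Definition rep (q : cyc) : F := @repr _ (Quotient.quot scomm_closed) q.

Lemma repK q : cls (rep q) = q. Proof. exact: reprK. Qed.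

Lemma clsP u v : cls u = cls v <-> scomm (u - v).
Proof.
rewrite /cls; split=> [/eqP|h].
  by rewrite -Quotient.idealrBE => /asboolP.
by apply/eqP; rewrite -Quotient.idealrBE; apply/asboolP.
Qed.

Lemma cls0P u : cls u = 0 <-> scomm u.
Proof.
have <- : cls 0 = 0 by rewrite /cls raddf0.
by rewrite clsP subr0.
Qed.

Lemma clsD u v : cls (u + v) = cls u + cls v.
Proof. exact: (raddfD (\pi_(Quotient.quot scomm_closed))). Qed.

Definition cyc_scale (c : K) (q : cyc) : cyc := cls (c *: rep q).

Lemma cyc_scaleE c u : cyc_scale c (cls u) = cls (c *: u).
Proof.
by apply/clsP; rewrite -scalerBr; apply/scommZ/clsP; rewrite repK.
Qed.

Fact cyc_scaleA a b q : cyc_scale a (cyc_scale b q) = cyc_scale (a * b) q.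
Proof. by rewrite -[q]repK !cyc_scaleE scalerA. Qed.
Fact cyc_scale1 : left_id 1 cyc_scale.
Proof. by move=> q; rewrite -[q]repK !cyc_scaleE scale1r. Qed.
Fact cyc_scaleDr : right_distributive cyc_scale +%R.
Proof.
by move=> a q r; rewrite -[q]repK -[r]repK -clsD !cyc_scaleE scalerDr clsD.
Qed.
Fact cyc_scaleDl q : {morph cyc_scale^~ q : a b / a + b}.
Proof. by move=> a b; rewrite -[q]repK !cyc_scaleE scalerDl clsD. Qed.

HB.instance Definition _ :=
  GRing.Zmodule_isLmodule.Build K cyc cyc_scaleA cyc_scale1 cyc_scaleDr cyc_scaleDl.

Lemma cls_linear : linear cls.
Proof. by move=> c u v; rewrite clsD -cyc_scaleE. Qed.

End Graded.

Lemma lin_D (K : fieldType) (U V : lmodType K) (f : U -> V) (a b : U) :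
  linear f -> f (a + b) = f a + f b.
Proof. by move=> lf; rewrite -[a]scale1r lf !scale1r. Qed.

Lemma lin_0 (K : fieldType) (U V : lmodType K) (f : U -> V) :
  linear f -> f 0 = 0.
Proof. by move=> lf; apply: (addrI (f 0)); rewrite -lin_D // !addr0. Qed.

Lemma lin_Z (K : fieldType) (U V : lmodType K) (f : U -> V) c (a : U) :
  linear f -> f (c *: a) = c *: f a.
Proof. by move=> lf; rewrite -[c *: a]addr0 lf lin_0 // addr0. Qed.

Lemma lin_big (K : fieldType) (U V : lmodType K) (f : U -> V) (J : Type)
    (r : seq J) (F : J -> U) :
  linear f -> f (\sum_(j <- r) F j) = \sum_(j <- r) f (F j).
Proof.
move=> lf; elim: r => [|j r IH]; first by rewrite !big_nil lin_0.
by rewrite !big_cons lin_D // IH.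
Qed.

Lemma sgn_eq (K : fieldType) (m n : nat) :
  odd m = odd n -> (-1) ^+ m = (-1) ^+ n :> K.
Proof. by move=> e; rewrite -signr_odd e signr_odd. Qed.

Lemma sgnz_nat (K : fieldType) (z : int) : (-1) ^ z = (-1) ^+ `|z| :> K.
Proof. by case: z => // n; rewrite NegzE -exprnN -signr_odd invr_sign signr_odd. Qed.

Lemma odd_pred_absz (m : nat) : odd `|m%:Z - 1|%N = odd m.+1.
Proof. by case: m => // m; rewrite -addn1 PoszD addrK /= addn1 negbK. Qed.

Lemma sgnz1 (K : fieldType) (m n : nat) :
  (-1) ^ ((m%:Z - 1) * n%:Z) = (-1) ^+ (m.+1 * n) :> K.
Proof. by rewrite sgnz_nat; apply: sgn_eq; rewrite abszM !oddM odd_pred_absz. Qed.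

Lemma sgnz2 (K : fieldType) (m n : nat) :
  (-1) ^ ((m%:Z - 1) * (n%:Z - 1)) = (-1) ^+ (m.+1 * n.+1) :> K.
Proof. by rewrite sgnz_nat; apply: sgn_eq; rewrite abszM !oddM !odd_pred_absz. Qed.

Section Words.
Context {K : fieldType} {I : choiceType}.
Local Notation F := (freealg K I).
Local Notation FF := (freealg2 K I).

Definition mon (s : seq I) : F := << FMonom s >>.
Definition mon2 (s t : seq I) : FF := << (FMonom s, FMonom t) >>.

Lemma mmulE (s t : seq I) : mmul (FMonom s) (FMonom t) = FMonom (s ++ t).
Proof. by apply: val_inj; rewrite /= fmM. Qed.

Lemma monM s t : mon s * mon t = mon (s ++ t).
Proof. by rewrite /mon malgM_def fgmulUU mulr1 mmulE. Qed.

Lemma mon0 : mon [::] = 1.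
Proof. by rewrite /mon -fmoneE. Qed.

Lemma mon_gen i : mon [:: i] = gen K i.
Proof. by rewrite /mon /gen fmuE. Qed.

Lemma tensE s t : tens (mon s) (mon t) = mon2 s t.
Proof. exact: bilextU. Qed.
Lemma outlE s t v : outl (mon v) (mon2 s t) = mon2 (v ++ s) t.
Proof. by rewrite /outl bilextU /= mmulE. Qed.
Lemma outrE s t v : outr (mon2 s t) (mon v) = mon2 s (t ++ v).
Proof. by rewrite /outr bilextU /= mmulE. Qed.
Lemma muE s t : mu (mon2 s t) = mon (s ++ t).
Proof. by rewrite /mu lextU /= mmulE. Qed.
Lemma mu_opE s t : mu_op (mon2 s t) = mon (t ++ s).
Proof. by rewrite /mu_op lextU /= mmulE. Qed.

Lemma outl_linl t : linear (fun v => outl v t : FF). Proof. exact: bilext_linl. Qed.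
Lemma outl_linr v : linear (outl v : FF -> FF). Proof. exact: bilext_linr. Qed.
Lemma outr_linl v : linear (fun t => outr t v : FF). Proof. exact: bilext_linl. Qed.
Lemma outr_linr t : linear (outr t : F -> FF). Proof. exact: bilext_linr. Qed.
Lemma mu_lin : linear (mu : FF -> F). Proof. exact: lext_linear. Qed.
Lemma mu_op_lin : linear (mu_op : FF -> F). Proof. exact: lext_linear. Qed.

Lemma mon_eq (V : lmodType K) (phi psi : F -> V) : linear phi -> linear psi ->
  (forall s, phi (mon s) = psi (mon s)) -> phi =1 psi.
Proof. by move=> l1 l2 e; apply: lin_eq => // -[s]; apply: e. Qed.

Lemma mon2_eq (V : lmodType K) (phi psi : FF -> V) : linear phi -> linear psi ->
  (forall s t, phi (mon2 s t) = psi (mon2 s t)) -> phi =1 psi.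
Proof. by move=> l1 l2 e; apply: lin_eq => // -[[s] [t]]; apply: e. Qed.

Lemma lin_id (U : lmodType K) : linear (fun u : U => u).
Proof. by []. Qed.

Lemma outl1 (t : FF) : outl (mon [::]) t = t.
Proof.
move: t; apply: (@mon2_eq FF (outl (mon [::])) (fun t => t)) => [||s t].
- exact: outl_linr.
- exact: lin_id.
- by rewrite outlE.
Qed.

Lemma outr1 (t : FF) : outr t (mon [::]) = t.
Proof.
move: t; apply: (@mon2_eq FF (fun t => outr t (mon [::])) (fun t => t)) => [||s t].
- exact: outr_linl.
- exact: lin_id.
- by rewrite outrE cats0.
Qed.

Fixpoint splits (s : seq I) : seq (seq I * I * seq I) :=
  if s is a :: s' then
    ([::], a, s') :: [seq (a :: p.1.1, p.1.2, p.2) | p <- splits s']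
  else [::].

Lemma splitsE s p : p \in splits s -> s = p.1.1 ++ p.1.2 :: p.2.
Proof.
elim: s p => [|a s IH] p //=; rewrite inE => /orP[/eqP -> //|/mapP[q qs ->]] /=.
by rewrite -(IH _ qs).
Qed.

Lemma splits_cat s t : splits (s ++ t) =
  [seq (p.1.1, p.1.2, p.2 ++ t) | p <- splits s] ++
  [seq (s ++ p.1.1, p.1.2, p.2) | p <- splits t].
Proof.
elim: s => [|a s IH] /=; first by rewrite -[LHS]map_id; apply: eq_map => -[[]].
by rewrite IH map_cat -!map_comp.
Qed.

Context (deg : I -> nat).

Definition sdeg (s : seq I) : nat := \sum_(i <- s) deg i.

Lemma sdeg_cat s t : sdeg (s ++ t) = (sdeg s + sdeg t)%N.
Proof. exact: big_cat. Qed.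
Lemma sdeg_cons a s : sdeg (a :: s) = (deg a + sdeg s)%N.
Proof. exact: big_cons. Qed.
Lemma sdeg_nil : sdeg [::] = 0%N.
Proof. exact: big_nil. Qed.

Lemma homog_mon s : homog deg (sdeg s) (mon s).
Proof. by move=> w; rewrite /mon msuppU oner_eq0 inE => /eqP ->. Qed.

Lemma homog_in n (u : F) s : homog deg n u -> FMonom s \in msupp u -> sdeg s = n.
Proof. by move=> h /h. Qed.

Lemma flipE s t : flip deg (mon2 s t) = (-1) ^+ (sdeg s * sdeg t) *: mon2 t s.
Proof. exact: lextU. Qed.

Lemma flip_lin : linear (flip deg : FF -> FF). Proof. exact: lext_linear. Qed.

Lemma cls_mon_comm s t :
  cls deg (mon (s ++ t)) = (-1) ^+ (sdeg s * sdeg t) *: cls deg (mon (t ++ s)).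
Proof.
rewrite -(lin_Z _ _ (cls_linear deg)); apply/clsP; rewrite -!monM.
have := scomm_cons 1 (@homog_mon s) (@homog_mon t) (scomm0 deg).
by rewrite addr0 scale1r.
Qed.

Lemma scomm_kill (V : lmodType K) (phi : F -> V) u : linear phi ->
  (forall s t, phi (mon (s ++ t)) = (-1) ^+ (sdeg s * sdeg t) *: phi (mon (t ++ s))) ->
  scomm deg u -> phi u = 0.
Proof.
move=> lp e; elim=> [|c m n v w s hv hw _ IH]; first exact: lin_0.
rewrite lp IH addr0; suff -> : phi (v * w - (-1) ^+ (m * n) *: (w * v)) = 0.
  exact: scaler0.
rewrite -scaleN1r addrC lp scaleN1r addrC lin_Z //; apply/eqP; rewrite subr_eq0; apply/eqP.
have lR x : linear (fun y : F => phi (x * y)) by apply: lin_comp (lin_mulr x) lp.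
have lL x : linear (fun y : F => phi (y * x)) by apply: lin_comp (lin_mull x) lp.
apply: (lin_eq_in (phi := fun v => phi (v * w))
  (psi := fun v => (-1) ^+ (m * n) *: phi (w * v))) => //; first exact: lin_scale.
move=> [s'] /(homog_in hv) <-.
apply: (lin_eq_in (phi := fun w => phi (mon s' * w))
  (psi := fun w => (-1) ^+ (sdeg s' * n) *: phi (w * mon s'))) => //; first exact: lin_scale.
by move=> [t] /(homog_in hw) <-; rewrite !monM e.
Qed.

End Words.

Lemma lin_bigZ (K : fieldType) (U V : lmodType K) (f : U -> V) (J : Type)
    (r : seq J) c (F : J -> U) :
  linear f -> c *: f (\sum_(j <- r) F j) = \sum_(j <- r) c *: f (F j).
Proof. by move=> lf; rewrite lin_big // scaler_sumr. Qed.

Lemma lin_bigNZ (K : fieldType) (U V : lmodType K) (f : U -> V) (J : Type)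
    (r : seq J) c (F : J -> U) :
  linear f -> - (c *: f (\sum_(j <- r) F j)) = \sum_(j <- r) - (c *: f (F j)).
Proof. by move=> lf; rewrite lin_bigZ // sumrN. Qed.

Lemma add_eq (V : zmodType) (a b c d : V) : a = c -> b = d -> a + b = c + d.
Proof. by move=> -> ->. Qed.

Lemma scale_eq (K : fieldType) (V : lmodType K) (a b : K) (v : V) :
  a = b -> a *: v = b *: v.
Proof. by move=> ->. Qed.

Section WordBracket.
Context {K : fieldType} {I : choiceType} (deg : I -> nat) (pc : I -> I -> K).
Local Notation F := (freealg K I).
Local Notation FF := (freealg2 K I).
Local Notation sd := (sdeg deg).

(* the sign of the term where the letter p.1.2 of u meets the letter q.1.2 *)
Definition bsgn (u : seq I) (p q : seq I * I * seq I) : nat :=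
  ((sd u).+1 * sd q.1.1 + (deg p.1.2 + sd p.1.1) * sd p.2)%N.

Definition dsw (u v : seq I) : FF :=
  \sum_(p <- splits u) \sum_(q <- splits v)
    ((-1) ^+ bsgn u p q * pc p.1.2 q.1.2) *:
      mon2 (q.1.1 ++ p.2) (p.1.1 ++ q.2).

Lemma dsw_cat u v w : dsw u (v ++ w) =
  (-1) ^+ ((sd u).+1 * sd v) *: outl (mon v) (dsw u w) + outr (dsw u v) (mon w).
Proof.
rewrite addrC {2 3}/dsw [X in _ = X + _](lin_big _ _ (outr_linl _)).
rewrite [X in _ = _ + X](lin_bigZ _ _ _ (outl_linr _)) -big_split.
apply: eq_bigr => p _ /=; rewrite splits_cat big_cat !big_map /=.
rewrite [X in _ = X + _](lin_big _ _ (outr_linl _)).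
rewrite [X in _ = _ + X](lin_bigZ _ _ _ (outl_linr _)).
apply: add_eq; apply: eq_bigr => q _.
  by rewrite [RHS](lin_Z _ _ (outr_linl _)) outrE catA.
rewrite [X in _ = _ *: X](lin_Z _ _ (outl_linr _)) outlE scalerA mulrA -exprD !catA.
apply: scale_eq; congr (_ ^+ _ * _).
by rewrite /bsgn /= sdeg_cat mulnDr !addnA.
Qed.

Context (pcN : forall i j, pc i j = - pc j i).
Context (pc_deg : forall i j, pc i j != 0 -> odd (deg i + deg j)).

Lemma dsw_antisym u v :
  dsw u v = - ((-1) ^+ ((sd u).+1 * (sd v).+1) *: flip deg (dsw v u)).
Proof.
rewrite {1}/dsw exchange_big /= /dsw [RHS](lin_bigNZ _ _ _ (flip_lin _)).
apply: eq_big_seq => q /splitsE /(congr1 sd); rewrite sdeg_cat sdeg_cons => ev.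
rewrite [RHS](lin_bigNZ _ _ _ (flip_lin _)).
apply: eq_big_seq => p /splitsE /(congr1 sd); rewrite sdeg_cat sdeg_cons => eu.
rewrite [flip _ _](lin_Z _ _ (flip_lin _)) flipE !scalerA -scaleNr; apply: scale_eq.
rewrite (pcN p.1.2) mulrN; congr (- _).
rewrite [X in _ = X * _]mulrA [RHS]mulrAC -!exprD.
have [->|/pc_deg od] := eqVneq (pc q.1.2 p.1.2) 0; first by rewrite !mulr0.
congr (_ * _); apply: sgn_eq.
rewrite /bsgn ev eu !sdeg_cat; move: od; rewrite !(oddD, oddM, oddS).
move: (odd (deg p.1.2)) (odd (deg q.1.2)) (odd (sd p.1.1)) (odd (sd p.2)).
by move: (odd (sd q.1.1)) (odd (sd q.2)) => [] [] [] [] [] [].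
Qed.

Definition cm (t : FF) : cyc deg := cls deg (mu t).

Lemma cm_lin : linear cm.
Proof. exact: lin_comp mu_lin (cls_linear deg). Qed.

Lemma cmE s t : cm (mon2 s t) = cls deg (mon (s ++ t)).
Proof. by rewrite /cm muE. Qed.

Lemma cm_flip t : cm (flip deg t) = cm t.
Proof.
move: t; apply: mon2_eq => [||s t]; [|exact: cm_lin|].
  exact: lin_comp (flip_lin deg) cm_lin.
rewrite flipE cmE [LHS](lin_Z _ _ cm_lin) cmE (cls_mon_comm deg t s).
by rewrite scalerA -exprD -signr_odd oddD mulnC addbb scale1r.
Qed.

Lemma dsw_cls u v w : cm (dsw u (v ++ w)) =
  (-1) ^+ (sd v * sd w) *: cm (dsw u (w ++ v)).
Proof.
pose lft (p q : seq I * I * seq I) (v w : seq I) : cyc deg := ((-1) ^+ bsgn u p q * pc p.1.2 q.1.2) *: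
  cls deg (mon ((q.1.1 ++ p.2) ++ (p.1.1 ++ q.2 ++ w))).
pose rgt (p q : seq I * I * seq I) (v w : seq I) : cyc deg := ((-1) ^+ (bsgn u p q + (sd u).+1 * sd w) * pc p.1.2 q.1.2) *:
  cls deg (mon (((w ++ q.1.1) ++ p.2) ++ (p.1.1 ++ q.2))).
have E v' w' : cm (dsw u (v' ++ w')) =
    \sum_(p <- splits u) (\sum_(q <- splits v') lft p q v' w' +
                          \sum_(q <- splits w') rgt p q w' v').
  rewrite /dsw [LHS](lin_big _ _ cm_lin); apply: eq_bigr => p _.
  rewrite splits_cat big_cat !big_map /= (lin_D _ _ cm_lin).
  rewrite [X in X + _](lin_big _ _ cm_lin) [X in _ + X](lin_big _ _ cm_lin).
  apply: add_eq; apply: eq_bigr => q _; rewrite [LHS](lin_Z _ _ cm_lin) cmE.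
    by apply: scale_eq.
  rewrite /rgt; apply: scale_eq; congr (_ ^+ _ * _).
  by rewrite /bsgn /= sdeg_cat mulnDr -addnA addnC.
have X p q v' w' : p \in splits u -> q \in splits v' ->
    lft p q v' w' = (-1) ^+ (sd v' * sd w') *: rgt p q v' w'.
  move=> /splitsE /(congr1 sd) + /splitsE /(congr1 sd).
  rewrite !sdeg_cat !sdeg_cons /lft /rgt => eu ev.
  rewrite -!catA catA catA catA cls_mon_comm !scalerA -!catA.
  apply: scale_eq.
  have [->|/pc_deg od] := eqVneq (pc p.1.2 q.1.2) 0; first by rewrite !mulr0 mul0r.
  rewrite mulrAC -exprD mulrA -exprD; congr (_ * _); apply: sgn_eq.
  rewrite /bsgn eu ev !sdeg_cat; move: od; rewrite !(oddD, oddM, oddS).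
  move: (odd (deg p.1.2)) (odd (deg q.1.2)) (odd (sd p.1.1)).
  by move: (odd (sd p.2)) (odd (sd q.1.1)) (odd (sd q.2)) (odd (sd w')) =>
    [] [] [] [] [] [] [].
rewrite !E scaler_sumr; apply: eq_big_seq => p pu.
rewrite scalerDr [RHS]addrC; apply: add_eq; rewrite scaler_sumr; apply: eq_big_seq => q qv.
  exact: X.
rewrite X // mulnC scalerA -exprD -signr_odd oddD addbb scale1r //.
Qed.

Definition dsch : F -> F -> FF :=
  bilext (fun u v : {fmonom I} => dsw u v).

Lemma dschE u v : dsch (mon u) (mon v) = dsw u v.
Proof. exact: bilextU. Qed.

Lemma dsch_linl v : linear (fun u => dsch u v). Proof. exact: bilext_linl. Qed.
Lemma dsch_linr u : linear (dsch u). Proof. exact: bilext_linr. Qed.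

Lemma dsch_leibniz m n u v w : homog deg m u -> homog deg n v ->
  dsch u (v * w) = (-1) ^+ (m.+1 * n) *: outl v (dsch u w) + outr (dsch u v) w.
Proof.
move=> hu hv.
apply: (lin_eq_in (phi := fun u => dsch u (v * w))
  (psi := fun u => (-1) ^+ (m.+1 * n) *: outl v (dsch u w) + outr (dsch u v) w)).
- exact: dsch_linl.
- apply: lin_add; last exact: lin_comp (dsch_linl _) (outr_linl _).
  by apply: lin_scale; exact: lin_comp (dsch_linl _) (outl_linr _).
move=> [u'] /(homog_in hu) <-; rewrite -/(mon u').
apply: (lin_eq_in (phi := fun v => dsch (mon u') (v * w))
  (psi := fun v => (-1) ^+ ((sd u').+1 * n) *: outl v (dsch (mon u') w) +
                   outr (dsch (mon u') v) w)).
- exact: lin_comp (lin_mull _) (dsch_linr _).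
- apply: lin_add; last exact: lin_comp (dsch_linr _) (outr_linl _).
  by apply: lin_scale; exact: outl_linl.
move=> [v'] /(homog_in hv) <-; rewrite -/(mon v').
move: w; apply: mon_eq => [||w].
- exact: lin_comp (lin_mulr _) (dsch_linr _).
- apply: lin_add; last exact: outr_linr.
  by apply: lin_scale; exact: lin_comp (dsch_linr _) (outl_linr _).
by rewrite monM !dschE dsw_cat.
Qed.

Lemma dsch_antisym m n u v : homog deg m u -> homog deg n v ->
  dsch u v = - ((-1) ^+ (m.+1 * n.+1) *: flip deg (dsch v u)).
Proof.
move=> hu hv; rewrite -scaleNr.
apply: (lin_eq_in (phi := fun u => dsch u v)
  (psi := fun u => (- (-1) ^+ (m.+1 * n.+1)) *: flip deg (dsch v u))).
- exact: dsch_linl.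
- by apply: lin_scale; exact: lin_comp (dsch_linr _) (flip_lin _).
move=> [u'] /(homog_in hu) <-; rewrite -/(mon u').
apply: (lin_eq_in (phi := fun v => dsch (mon u') v)
  (psi := fun v => (- (-1) ^+ ((sd u').+1 * n.+1)) *: flip deg (dsch v (mon u')))).
- exact: dsch_linr.
- by apply: lin_scale; exact: lin_comp (dsch_linl _) (flip_lin _).
move=> [v'] /(homog_in hv) <-; rewrite -/(mon v').
by rewrite !dschE scaleNr dsw_antisym.
Qed.

Lemma dsch_scommr u s : scomm deg s -> cm (dsch u s) = 0.
Proof.
move=> hs; move: u; apply: mon_eq => [||u].
- exact: lin_comp (dsch_linl _) cm_lin.
- by move=> c x y; rewrite scaler0 addr0.
apply: (scomm_kill (phi := fun s => cm (dsch (mon u) s))) hs.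
  exact: lin_comp (dsch_linr _) cm_lin.
by move=> v w; rewrite !dschE dsw_cls.
Qed.

Lemma dsch_scomml s v : scomm deg s -> cm (dsch s v) = 0.
Proof.
move=> hs; move: v; apply: mon_eq => [||v].
- exact: lin_comp (dsch_linr _) cm_lin.
- by move=> c x y; rewrite scaler0 addr0.
have A u : cm (dsch (mon u) (mon v)) =
    (- (-1) ^+ ((sd u).+1 * (sd v).+1)) *: cm (dsch (mon v) (mon u)).
  rewrite (dsch_antisym (@homog_mon _ _ deg u) (@homog_mon _ _ deg v)) -scaleNr.
  by rewrite [LHS](lin_Z _ _ cm_lin) cm_flip.
apply: (scomm_kill (phi := fun s => cm (dsch s (mon v)))) hs.
  exact: lin_comp (dsch_linl _) cm_lin.
move=> u w /=; rewrite [LHS]A.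
rewrite [X in _ = _ *: X]A.
rewrite !dschE [X in _ *: X = _]dsw_cls.
rewrite !sdeg_cat (addnC (sd u)).
rewrite [LHS]scalerA [RHS]scalerA.
by rewrite mulrC.
Qed.

End WordBracket.

(* The letter of x is the index 0 and that of y the index 1.  In the alphabet of
   T, inl i is the i-th coordinate and inr i the partial double derivation with
   respect to it. *)
Definition letA : choiceType := Choice.clone 'I_2 _.
Definition letT : choiceType := Choice.clone (letA + letA)%type _.
Notation algA K := (freealg K letA).
Notation algAA K := (freealg2 K letA).
Notation algT K := (freealg K letT).
Notation algTT K := (freealg2 K letT).

Definition ix : letA := ord0.
Definition iy : letA := ord_max.

Definition degA (i : letA) : nat := 0.
Definition degT (l : letT) : nat := if l is inr _ then 1 else 0.

Notation cycA K := (@cyc K letA degA).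
Notation cycT K := (@cyc K letT degT).

Section Schouten.
Context {K : fieldType}.

(* d = d/dx_i; by [dpartP] and [dpartial_unique] exactly one d satisfies this. *)
Record is_dpartial (i : letA) (d : algA K -> algAA K) : Prop := IsDPartial {
  dpartial_lin : linear d;
  dpartial_leibniz : forall a b, d (a * b) = outl a (d b) + outr (d a) b;
  dpartial_gen : forall j, d (gen K j) = (i == j)%:R *: tens 1 1
}.

Definition coordT (i : letA) : algT K := gen K (inl i).
Definition derT (i : letA) : algT K := gen K (inr i).

(* D = {{-, -}}; by [dsch0P] and [dschouten_unique] exactly one D satisfies
   this. *)
Record is_dschouten (D : algT K -> algT K -> algTT K) : Prop := IsDSchouten {
  dschouten_linl : forall v, linear (fun u => D u v);
  dschouten_linr : forall u, linear (D u);
  dschouten_coord : forall i j, D (coordT i) (coordT j) = 0;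
  dschouten_der : forall i j, D (derT i) (derT j) = 0;
  dschouten_eval : forall i j, D (derT i) (coordT j) = (i == j)%:R *: tens 1 1;
  dschouten_leibniz : forall m n p u v w,
    homog degT m u -> homog degT n v -> homog degT p w ->
    D u (v * w) =
      (-1) ^ ((m%:Z - 1) * n%:Z) *: outl v (D u w) + outr (D u v) w;
  dschouten_antisym : forall m n u v,
    homog degT m u -> homog degT n v ->
    D u v = - ((-1) ^ ((m%:Z - 1) * (n%:Z - 1)) *: flip degT (D v u))
}.

(* The bracket induced on T / [T, T] by {-, -} = mu ∘ {{-, -}}; it is computed
   on chosen representatives, see [schouten_cls] for the independence. *)
Definition schouten (D : algT K -> algT K -> algTT K) (p q : cycT K) : cycT K :=
  cls degT (mu (D (rep p) (rep q))).

(* The inclusion A -> T and the map A / [A, A] -> T / [T, T] it induces, see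
   [incl_cycE]. *)
Definition incl : algA K -> algT K :=
  lext (fun w : {fmonom letA} => << FMonom [seq (inl i : letT) | i <- w] >>).

Definition incl_cyc (q : cycA K) : cycT K := cls degT (incl (rep q)).

Definition dP (D : algT K -> algT K -> algTT K) (P : cycT K) : cycT K -> cycT K :=
  schouten D P.

(* q ∈ H^0_P(A), the kernel of d_P on A / [A, A] *)
Definition H0 (D : algT K -> algT K -> algTT K) (P : cycT K) (q : cycA K) : Prop :=
  dP D P (incl_cyc q) = 0.

Lemma incl_lin : linear incl. Proof. exact: lext_linear. Qed.

Lemma inclE s : incl (mon s) = mon [seq (inl i : letT) | i <- s]. Proof. exact: lextU. Qed.

Lemma inclM a b : incl (a * b) = incl a * incl b.
Proof.
apply: (mon_eq (phi := fun a => incl (a * b)) (psi := fun a => incl a * incl b)).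
- exact: lin_comp (lin_mull b) incl_lin.
- exact: lin_comp incl_lin (lin_mull _).
move=> s; apply: (mon_eq (phi := fun b => incl (mon s * b))
                         (psi := fun b => incl (mon s) * incl b)).
- exact: lin_comp (lin_mulr _) incl_lin.
- exact: lin_comp incl_lin (lin_mulr _).
by move=> t; rewrite monM !inclE monM map_cat.
Qed.

Lemma incl1 : incl 1 = 1.
Proof. by rewrite -mon0 inclE mon0. Qed.

Lemma incl_gen i : incl (gen K i) = coordT i.
Proof. by rewrite -mon_gen inclE mon_gen. Qed.

Lemma sdegA s : sdeg degA s = 0%N.
Proof. exact: big1. Qed.

Lemma sdegT_inl s : sdeg degT (map inl s) = 0%N.
Proof. by rewrite /sdeg big_map big1. Qed.

Lemma cls_eq (I : choiceType) (deg : I -> nat) (V : lmodType K)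
    (phi : freealg K I -> V) u v : linear phi ->
  (forall s, scomm deg s -> phi s = 0) -> cls deg u = cls deg v -> phi u = phi v.
Proof.
move=> lp k /clsP /k; rewrite -scaleN1r addrC lp scaleN1r => /eqP.
by rewrite addrC subr_eq0 => /eqP.
Qed.

Lemma incl_cycE a : incl_cyc (cls degA a) = cls degT (incl a).
Proof.
apply: (@cls_eq _ degA _ (fun a => cls degT (incl a))); last exact: repK.
  exact: lin_comp incl_lin (cls_linear degT).
move=> s; apply: (@scomm_kill _ _ degA _ (fun a => cls degT (incl a))).
  exact: lin_comp incl_lin (cls_linear degT).
by move=> t w; rewrite !inclE !map_cat cls_mon_comm !sdegT_inl !sdegA.
Qed.

Definition dpart (i : letA) : algA K -> algAA K :=
  lext (fun w : {fmonom letA} => \sum_(p <- splits w) (i == p.1.2)%:R *: mon2 p.1.1 p.2).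

Lemma dpart_lin i : linear (dpart i). Proof. exact: lext_linear. Qed.

Lemma dpartE i s :
  dpart i (mon s) = \sum_(p <- splits s) (i == p.1.2)%:R *: mon2 p.1.1 p.2.
Proof. exact: lextU. Qed.

Lemma dpartP i : is_dpartial i (dpart i).
Proof.
split=> [|a b|j]; first exact: dpart_lin.
- apply: (mon_eq (phi := fun a => dpart i (a * b))
    (psi := fun a => outl a (dpart i b) + outr (dpart i a) b)).
  + exact: lin_comp (lin_mull b) (dpart_lin i).
  + by apply: lin_add (outl_linl _) (lin_comp (dpart_lin i) (outr_linl _)).
  move=> s; apply: (mon_eq (phi := fun b => dpart i (mon s * b))
    (psi := fun b => outl (mon s) (dpart i b) + outr (dpart i (mon s)) b)).
  + exact: lin_comp (lin_mulr _) (dpart_lin i).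
  + by apply: lin_add (lin_comp (dpart_lin i) (outl_linr _)) (outr_linr _).
  move=> t; rewrite monM !dpartE splits_cat big_cat !big_map /= addrC.
  rewrite (lin_big _ _ (outl_linr _)) (lin_big _ _ (outr_linl _)).
  congr (_ + _); apply: eq_bigr => p _.
    by rewrite (lin_Z _ _ (outl_linr _)) outlE.
  by rewrite (lin_Z _ _ (outr_linl _)) outrE.
- by rewrite -mon_gen dpartE /= big_seq1 -mon0 tensE.
Qed.

Lemma dpartial_unique i d1 d2 :
  is_dpartial i d1 -> is_dpartial i d2 -> d1 =1 d2.
Proof.
move=> h1 h2; apply: mon_eq => [||s]; [exact: dpartial_lin h1|exact: dpartial_lin h2|].
elim: s => [|a s IH].
  have z d : is_dpartial i d -> d (mon [::]) = 0.
    move=> h; apply: (addrI (d (mon [::]))); rewrite addr0.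
    by have := dpartial_leibniz h (mon [::]) (mon [::]); rewrite monM outl1 outr1.
  by rewrite !z.
rewrite -cat1s -monM (dpartial_leibniz h1) (dpartial_leibniz h2) IH mon_gen.
by rewrite (dpartial_gen h1) (dpartial_gen h2).
Qed.

Definition pairing (p q : letT) : K :=
  match p, q with
  | inr i, inl j => (i == j)%:R
  | inl i, inr j => - (i == j)%:R
  | _, _ => 0
  end.

Lemma pairingN p q : pairing p q = - pairing q p.
Proof. by case: p q => i [] j /=; rewrite ?oppr0 ?opprK // eq_sym. Qed.

Lemma pairing_deg p q : pairing p q != 0 -> odd (degT p + degT q).
Proof. by case: p q => i [] j //=; rewrite eqxx. Qed.

Definition dsch0 : algT K -> algT K -> algTT K := dsch degT pairing.

Lemma dsch0_gen p q : dsch0 (gen K p) (gen K q) = pairing p q *: tens 1 1.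
Proof.
rewrite -!mon_gen /dsch0 dschE /dsw /= !big_seq1 /= -mon0 tensE.
by rewrite /bsgn /= !sdeg_nil !muln0 mul1r.
Qed.

Lemma dsch0P : is_dschouten dsch0.
Proof.
split=> [v|u|i j|i j|i j|m n p u v w hu hv _|m n u v hu hv].
- exact: dsch_linl.
- exact: dsch_linr.
- by rewrite dsch0_gen scale0r.
- by rewrite dsch0_gen scale0r.
- by rewrite dsch0_gen.
- by rewrite sgnz1; apply: dsch_leibniz.
- by rewrite sgnz2; apply: (dsch_antisym pairingN pairing_deg).
Qed.

Lemma homog_gen l : homog degT (degT l) (gen K l).
Proof.
have := @homog_mon K _ degT [:: l].
by rewrite mon_gen sdeg_cons sdeg_nil addn0.
Qed.

Lemma dschouten_eq_words D1 D2 m u : is_dschouten D1 -> is_dschouten D2 ->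
  homog degT m u -> (forall l, D1 u (gen K l) = D2 u (gen K l)) ->
  forall s, D1 u (mon s) = D2 u (mon s).
Proof.
move=> h1 h2 hu e; elim=> [|l s IH].
  have z D : is_dschouten D -> D u (mon [::]) = 0.
    move=> h; apply: (addrI (D u (mon [::]))); rewrite addr0.
    have h0 : homog degT 0 (mon [::] : algT K).
      by have := @homog_mon K _ degT [::]; rewrite sdeg_nil.
    have := dschouten_leibniz h hu h0 h0.
    by rewrite monM outl1 outr1 mulr0 expr0z scale1r.
  by rewrite !z.
have E D : is_dschouten D -> D u (mon (l :: s)) =
    (-1) ^ ((m%:Z - 1) * (degT l)%:Z) *: outl (gen K l) (D u (mon s)) +
    outr (D u (gen K l)) (mon s).
  move=> h; rewrite -cat1s -monM mon_gen.
  have := dschouten_leibniz h hu (@homog_gen l) (@homog_mon K _ degT s).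
  exact.
by rewrite (E _ h1) (E _ h2) IH e.
Qed.

Lemma dschouten_unique D1 D2 : is_dschouten D1 -> is_dschouten D2 ->
  forall u v, D1 u v = D2 u v.
Proof.
move=> h1 h2 u v.
have gg l l' : D1 (gen K l) (gen K l') = D2 (gen K l) (gen K l').
  case: l l' => i [] j.
  - by rewrite (dschouten_coord h1) (dschouten_coord h2).
  - rewrite (dschouten_antisym h1 (@homog_gen (inl i)) (@homog_gen (inr j))).
    rewrite (dschouten_antisym h2 (@homog_gen (inl i)) (@homog_gen (inr j))).
    by rewrite (dschouten_eval h1) (dschouten_eval h2).
  - by rewrite (dschouten_eval h1) (dschouten_eval h2).
  - by rewrite (dschouten_der h1) (dschouten_der h2).
have gw l s : D1 (gen K l) (mon s) = D2 (gen K l) (mon s).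
  exact: (dschouten_eq_words h1 h2 (@homog_gen l)).
have wg s l : D1 (mon s) (gen K l) = D2 (mon s) (gen K l).
  rewrite (dschouten_antisym h1 (@homog_mon K _ degT s) (@homog_gen l)).
  by rewrite (dschouten_antisym h2 (@homog_mon K _ degT s) (@homog_gen l)) gw.
have ww s t : D1 (mon s) (mon t) = D2 (mon s) (mon t).
  exact: (dschouten_eq_words h1 h2 (@homog_mon K _ degT s)).
move: v; apply: mon_eq (dschouten_linr h1 u) (dschouten_linr h2 u) _ => t.
move: u; exact: mon_eq (dschouten_linl h1 _) (dschouten_linl h2 _) _.
Qed.

(* {-, -} is well defined on T / [T, T] *)
Lemma schouten_cls D u v : is_dschouten D ->
  schouten D (cls degT u) (cls degT v) = cls degT (mu (D u v)).
Proof.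
move=> h; rewrite /schouten !(dschouten_unique h dsch0P).
change (cm degT (dsch0 (rep (cls degT u)) (rep (cls degT v))) =
        cm degT (dsch0 u v)).
transitivity (cm degT (dsch0 (rep (cls degT u)) v)).
  apply: (@cls_eq _ degT _ (fun v => cm degT (dsch0 _ v))); last exact: repK.
    exact: lin_comp (dsch_linr _ _ _) (cm_lin _).
  by move=> s hs; apply: dsch_scommr pairing_deg _ _ hs.
apply: (@cls_eq _ degT _ (fun u => cm degT (dsch0 u v))); last exact: repK.
  exact: lin_comp (dsch_linl _ _ _) (cm_lin _).
by move=> s hs; apply: dsch_scomml pairingN pairing_deg _ _ hs.
Qed.

End Schouten.

(* Main.v *)
Require Import Defs.
From HB Require Import structures.
From mathcomp Require Import all_boot all_order all_algebra ring_quotient.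
From mathcomp Require Import monalg.

Import GRing.Theory.
Local Open Scope ring_scope.

(** Why it is true.  Write P as the word x d/dx x d/dy.  In the double bracket
    of P with a word f in x and y, a contribution pairs one letter d/dx_j of P
    with one occurrence of x_j in f; after multiplication, the word f is cut
    open at that occurrence, and the rest of P is inserted in the gap.  Up to
    cyclic rotation this is (f'' f') followed by the letters of P after, then
    before, d/dx_j, and (f'' f') is a term of the cyclic derivative
    [cycder j f].  The letter d/dx carries a sign because the odd letter d/dy
    moves past it, the letter d/dy carries none; this is [dP_formula].

    For the kernel, words containing a single odd letter can be rotated in one
    way only so that this letter comes last, hence (T / [T, T])_1 is the sum of
    a copy of A for each of d/dx and d/dy.  The map [dercoef j] reads off the
    component of d/dx_j, so d_P f = 0 forces x (cycder_y f) x = 0 and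
    x (cycder_x f) x = 0, and both cyclic derivatives vanish because
    multiplication by a letter is injective ([sandwich_eq0]).  Finally a cyclic
    Euler identity holds modulo [A, A]: the sum of x_i (cycder_i f) is f with
    each word multiplied by its length ([euler_cyc]).  In characteristic 0 the
    lengths of nonempty words are invertible, and dividing by them is
    compatible with [A, A], so f is congruent to its constant term
    ([euler_const]).  The constants inject in A / [A, A] because the
    coefficient of the empty word vanishes on commutators. *)

(** * Sums over the occurrences of letters in a word *)

Lemma splits_map (I J : choiceType) (h : I -> J) (s : seq I) :
  splits (map h s) = [seq (map h p.1.1, h p.1.2, map h p.2) | p <- splits s].
Proof. by elim: s => //= a s ->; rewrite -!map_comp. Qed.

Lemma size_splits (I : choiceType) (s : seq I) : size (splits s) = size s.
Proof. by elim: s => //= a s IH; rewrite size_map IH. Qed.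

Lemma big_splits_cat (I : choiceType) (V : nmodType) (s t : seq I)
    (F : seq I * I * seq I -> V) :
  \sum_(p <- splits (s ++ t)) F p =
    \sum_(p <- splits s) F (p.1.1, p.1.2, p.2 ++ t) +
    \sum_(p <- splits t) F (s ++ p.1.1, p.1.2, p.2).
Proof. by rewrite splits_cat big_cat !big_map. Qed.

(** * Linearity and rotation *)

Section Words.
Context {K : fieldType} {I : choiceType}.

Lemma mulmonZ (c : K) (s : seq I) (u : freealg K I) : mon s * (c *: u) = c *: (mon s * u).
Proof. exact: (lin_Z c u (lin_mulr (mon s))). Qed.

Lemma mu_opZ (c : K) (t : freealg2 K I) : mu_op (c *: t) = c *: mu_op t.
Proof. exact: (lin_Z c t mu_op_lin). Qed.

Lemma mu_op_sum (J : Type) (r : seq J) (F : J -> freealg2 K I) :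
  mu_op (\sum_(j <- r) F j) = \sum_(j <- r) mu_op (F j).
Proof. exact: (lin_big r F mu_op_lin). Qed.

Context (deg : I -> nat).

Lemma clsZ (c : K) (u : freealg K I) : cls deg (c *: u) = c *: cls deg u.
Proof. exact: (lin_Z c u (cls_linear deg)). Qed.

Lemma clsB (u v : freealg K I) : cls deg (u - v) = cls deg u - cls deg v.
Proof. exact: raddfB. Qed.

Lemma cls_sum (J : Type) (r : seq J) (F : J -> freealg K I) :
  cls deg (\sum_(j <- r) F j) = \sum_(j <- r) cls deg (F j).
Proof. exact: (lin_big r F (cls_linear deg)). Qed.

Lemma cls_rotate0 (s t : seq I) : sdeg deg s = 0%N ->
  cls deg (mon (s ++ t) : freealg K I) = cls deg (mon (t ++ s)).
Proof. by move=> e; rewrite cls_mon_comm e mul0n scale1r. Qed.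

End Words.

Lemma letA_cases (i : letA) : i = ix \/ i = iy.
Proof. by case: i => -[|[|//]] lti; [left|right]; apply: val_inj. Qed.

(** * Cyclic derivatives and the Euler identity *)

Section CyclicDerivative.
Context {K : fieldType}.

(** The f'' f' of the statement: the derivative of f, seen as a cyclic word, with
    respect to the i-th coordinate. *)
Definition cycder (i : letA) (a : algA K) : algA K := mu_op (dpart i a).

Lemma cycder_lin i : linear (cycder i).
Proof. exact: lin_comp (dpart_lin i) mu_op_lin. Qed.

Lemma cycderE i s : cycder i (mon s) =
  \sum_(p <- splits s) (i == p.1.2)%:R *: mon (p.2 ++ p.1.1).
Proof.
rewrite /cycder dpartE mu_op_sum; apply: eq_bigr => p _.
by rewrite mu_opZ mu_opE.
Qed.

Lemma cycder1 i : cycder i 1 = 0.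
Proof. by rewrite -mon0 cycderE big_nil. Qed.

Lemma cycder_scalar i (c : K) : cycder i c%:A = 0.
Proof. by rewrite (lin_Z _ _ (cycder_lin i)) cycder1 scaler0. Qed.

Definition sizescale (c : nat -> K) : algA K -> algA K :=
  lext (fun w : {fmonom letA} => c (size w) *: << w >>).

Lemma sizescale_lin c : linear (sizescale c).
Proof. exact: lext_linear. Qed.

Lemma sizescaleE c s : sizescale c (mon s) = c (size s) *: mon s.
Proof. exact: lextU. Qed.

(** Both halves s t and t s of a commutator of words have the same length, so
    weighting words by their length preserves [A, A]. *)
Lemma sizescale_scomm c a : cls degA a = 0 -> cls degA (sizescale c a) = 0.
Proof.
move/cls0P; apply: (scomm_kill (phi := fun a => cls degA (sizescale c a))).
  exact: lin_comp (sizescale_lin c) (cls_linear degA).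
move=> s t; rewrite !sizescaleE [LHS]clsZ [X in _ = _ *: X]clsZ.
by rewrite [RHS]scalerA mulrC -[RHS]scalerA -cls_mon_comm !size_cat addnC.
Qed.

(** Cutting a cyclic word open at an occurrence of x_i and putting x_i back gives
    a rotation of the word; summing over i counts each occurrence of a letter
    once. *)
Lemma euler_cyc a :
  cls degA (\sum_(i : 'I_2) gen K (i : letA) * cycder i a) =
  cls degA (sizescale (fun n => n%:R) a).
Proof.
move: a; apply: mon_eq => [||s].
- apply: lin_comp (cls_linear degA) => c a b.
  rewrite scaler_sumr -big_split; apply: eq_bigr => i _ /=.
  exact: (lin_comp (cycder_lin i) (lin_mulr (gen K (i : letA)))).
- exact: lin_comp (sizescale_lin _) (cls_linear degA).
rewrite sizescaleE cls_sum.
have -> : \sum_(i : 'I_2) cls degA (gen K (i : letA) * cycder i (mon s)) =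
    \sum_(i : 'I_2) \sum_(p <- splits s) (i == p.1.2)%:R *: cls degA (mon s).
  apply: eq_bigr => i _; rewrite cycderE mulr_sumr cls_sum.
  apply: eq_big_seq => p /splitsE es; rewrite -mon_gen mulmonZ clsZ monM.
  have [ei|_] := eqVneq i p.1.2; last by rewrite !scale0r.
  rewrite -ei -cat1s in es; congr (_ *: _); rewrite es.
  by rewrite [RHS](@cls_rotate0 K _ degA _ _ (sdegA _)) catA.
rewrite exchange_big /=.
rewrite (eq_bigr (fun=> cls degA (mon s))) => [|p _]; last first.
  rewrite (bigD1 (p.1.2 : 'I_2)) //= eqxx scale1r big1 ?addr0 // => i /eqP ne.
  by case: eqP => // _; rewrite scale0r.
by rewrite big_const_seq count_predT iter_addr_0 clsZ scaler_nat size_splits.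
Qed.

(** The coefficient of the empty word is a linear form that separates the scalars
    and kills s t - t s, as s t is empty exactly when t s is. *)
Lemma cls_scalar_inj : injective (fun c : K => cls degA (c%:A : algA K)).
Proof.
move=> c d /clsP; rewrite -scalerBl => h.
(* Written with K^o because the target has to be a module over K. *)
have lphi : linear (fun a : algA K => mcoeff (FMonom [::]) a : K^o).
  by move=> k a b; rewrite mcoeffD mcoeffZ.
have := scomm_kill lphi _ h; rewrite -mon0 mcoeffZ mcoeffU eqxx mulr1 => e.
apply/eqP; rewrite -subr_eq0; apply/eqP; apply: e => s t.
rewrite !sdegA scale1r !mcoeffU; congr (_ *+ nat_of_bool _).
by case: s t => [|a s] [|b t] //; rewrite cats0.
Qed.

(** The Euler identity gives the class of f weighted by lengths; the weights n^-1
    undo this on nonempty words, and the convention 0^-1 = 0 removes exactly the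
    constant term. *)
Lemma euler_const a : [pchar K] =i pred0 -> (forall i, cycder i a = 0) ->
  exists c : K, cls degA a = cls degA (c%:A : algA K).
Proof.
move=> char0 a0; exists (mcoeff (FMonom [::]) a).
have := euler_cyc a; rewrite big1 => [|i _]; last by rewrite a0 mulr0.
rewrite {1}/cls raddf0 => /esym/(sizescale_scomm (fun n => n%:R^-1)).
suff -> : sizescale (fun n => n%:R^-1) (sizescale (fun n => n%:R) a) =
          a - (mcoeff (FMonom [::]) a)%:A by move=> /cls0P/clsP.
move: a {a0}; apply: mon_eq => [||s].
- exact: lin_comp (sizescale_lin _) (sizescale_lin _).
- by move=> c a b; rewrite mcoeffD mcoeffZ scalerDl -scalerA scalerBr opprD addrACA.
rewrite sizescaleE (lin_Z _ _ (sizescale_lin _)) sizescaleE scalerA.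
rewrite -mon0 mcoeffU; case: s => [|l s].
  by rewrite eqxx mul0r scale0r scale1r subrr.
rewrite mulfV ?scale1r ?scale0r ?subr0 //.
by rewrite (pcharf0P _).1.
Qed.

End CyclicDerivative.

(** * The components of degree one of T modulo commutators *)

Section Components.
Context {K : fieldType}.

(** The letter of A underneath a letter of T, so that a word without odd letters
    is read back as a word of A. *)
Definition basept (l : letT) : letA := match l with inl i => i | inr i => i end.

(** The coefficient of d/dx_j in degree one: u (d/dx_j) v is v u (d/dx_j) modulo
    commutators, since u and v are even, hence the value v u.  Words of any other
    degree are sent to 0; otherwise [dercoef_scomm] would fail for the
    commutators of two odd words. *)
Definition dercoef_word (j : letA) (w : seq letT) : algA K :=
  (sdeg degT w == 1%N)%:R *: \sum_(p <- splits w)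
    (inr j == p.1.2 :> letT)%:R *: mon (map basept (p.2 ++ p.1.1)).

Definition dercoef (j : letA) : algT K -> algA K :=
  lext (fun w : {fmonom letT} => dercoef_word j w).

Lemma dercoef_lin j : linear (dercoef j).
Proof. exact: lext_linear. Qed.

Lemma dercoefE j w : dercoef j (mon w) = dercoef_word j w.
Proof. exact: lextU. Qed.

(** In degree one, one of s and t is even, so that s t and t s are congruent
    without sign; for each occurrence of d/dx_j the rest of the word is the same
    when read cyclically from it. *)
Lemma dercoef_scomm j u : scomm degT u -> dercoef j u = 0.
Proof.
apply: scomm_kill (dercoef_lin j) _ => s t; rewrite !dercoefE /dercoef_word.
rewrite !sdeg_cat (addnC (sdeg degT t)).
have [e1|_] := eqVneq (sdeg degT s + sdeg degT t)%N 1%N; last by rewrite !scale0r scaler0.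
have -> : (sdeg degT s * sdeg degT t)%N = 0%N.
  by case: (sdeg degT s) (sdeg degT t) e1 => [|[|m]] [|n].
rewrite expr0 [RHS]scale1r; congr (_ *: _).
rewrite (big_splits_cat _ _ s t).
rewrite (big_splits_cat _ _ t s).
rewrite [LHS]addrC /=.
by apply: add_eq; apply: eq_bigr => p _; rewrite catA.
Qed.

Lemma dercoef_incl i j a : dercoef j (incl a * derT i) = (j == i)%:R *: a.
Proof.
move: a; apply: mon_eq => [||s].
- exact: lin_comp incl_lin (lin_comp (lin_mull _) (dercoef_lin j)).
- by move=> c x y; rewrite scalerDr !scalerA mulrC.
rewrite inclE /derT -mon_gen monM dercoefE /dercoef_word.
rewrite sdeg_cat sdegT_inl sdeg_cons sdeg_nil eqxx scale1r.
rewrite big_splits_cat splits_map big_map big1 => [|p _]; last by rewrite scale0r.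
by rewrite add0r big_seq1 /= cats0 -map_comp map_id.
Qed.

Definition strip (s : seq letA) : seq letA :=
  if s is a :: s' then behead (belast a s') else [::].

(** A left inverse deletes the first and the last letter of each word. *)
Lemma mul_gen_inj i (a : algA K) : gen K i * a * gen K i = 0 -> a = 0.
Proof.
pose st : algA K -> algA K := lext (fun w : {fmonom letA} => mon (strip w)).
have lst : linear st by exact: lext_linear.
have stK : (fun a => st (gen K i * a * gen K i)) =1 id.
  apply: mon_eq => [|//|s].
    exact: lin_comp (lin_mulr _) (lin_comp (lin_mull _) lst).
  rewrite -mon_gen !monM /st lextU; congr mon.
  by rewrite /= cats1 belast_rcons.
by move=> e; rewrite -[a]stK /= e (lin_0 lst).
Qed.

(** * The bracket with the Poisson tensor *)

Definition sandwich (i : letA) (a : algA K) : algT K :=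
  incl (gen K ix * a * gen K ix) * derT i.

Lemma sandwich_lin i : linear (sandwich i).
Proof.
exact: lin_comp (lin_comp (lin_comp (lin_mulr _) (lin_mull _)) incl_lin) (lin_mull _).
Qed.

Lemma sandwich_word i s :
  sandwich i (mon s) = mon (inl ix :: map inl s ++ [:: inl ix; inr i]).
Proof.
rewrite /sandwich -!mon_gen !monM inclE /derT -mon_gen monM; congr mon.
by rewrite !map_cat /= -catA.
Qed.

(** The cyclic derivative of the word s, closed up with the word w inserted in
    the gap left by the letter; both sides of the formula for d_P are signed sums
    of such classes. *)
Definition necklace_der (j : letA) (s : seq letA) (w : seq letT) : cycT K :=
  \sum_(q <- splits s) (j == q.1.2)%:R *:
    cls degT (mon (map inl (q.2 ++ q.1.1) ++ w)).

Lemma cls_sandwich i j s :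
  cls degT (sandwich i (cycder j (mon s))) =
  necklace_der j s [:: inl ix; inr i; inl ix].
Proof.
rewrite cycderE.
have lin := lin_comp (sandwich_lin i) (cls_linear degT).
rewrite [LHS](lin_big _ _ lin); apply: eq_bigr => q _.
rewrite [LHS](lin_Z _ _ lin) sandwich_word -[inl ix :: _]cat1s.
have x0 : sdeg degT [:: inl ix] = 0%N by rewrite sdeg_cons sdeg_nil.
by rewrite [in LHS](@cls_rotate0 K _ degT _ _ x0) -catA.
Qed.

(** Against a word in the coordinates only the odd letters d/dx_j of u pair; the
    even letters of s can be moved to the front without sign, and what remains is
    the rest of u, read cyclically from d/dx_j. *)
Lemma cm_dsw_coord (u : seq letT) (s : seq letA) :
  cm degT (dsw degT (@pairing K) u (map inl s)) =
  \sum_(p <- splits u)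
    if p.1.2 is inr j then
      (-1) ^+ ((sdeg degT p.1.1).+1 * sdeg degT p.2) *:
        necklace_der j s (p.2 ++ p.1.1)
    else 0.
Proof.
rewrite /dsw [LHS](lin_big _ _ (cm_lin degT)); apply: eq_bigr => -[[a l] b] _ /=.
rewrite [LHS](lin_big _ _ (cm_lin degT)) splits_map big_map.
case: l => [i|j]; first by rewrite big1 // => q _; rewrite /= mulr0 scale0r (lin_0 (cm_lin degT)).
rewrite [RHS]scaler_sumr; apply: eq_bigr => q _ /=.
rewrite [LHS](lin_Z _ _ (cm_lin degT)) Defs.cmE /bsgn /= sdegT_inl muln0 add0n add1n.
rewrite [RHS]scalerA map_cat -!catA.
by rewrite [in RHS](@cls_rotate0 K _ degT _ _ (sdegT_inl _)) -!catA.
Qed.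

Definition tensorP : algT K := coordT ix * derT ix * coordT ix * derT iy.

Lemma tensorPE : tensorP = mon [:: inl ix; inr ix; inl ix; inr iy].
Proof. by rewrite /tensorP /coordT /derT -!mon_gen !monM. Qed.

(** The words inserted are x d/dy x for the letter d/dx and x d/dx x for the
    letter d/dy. *)
Lemma bracketP_word (s : seq letA) :
  cm degT (dsch0 tensorP (incl (mon s))) =
  cls degT (sandwich ix (cycder iy (mon s)) - sandwich iy (cycder ix (mon s))).
Proof.
rewrite tensorPE inclE /dsch0 dschE cm_dsw_coord.
rewrite clsB [X in _ = X - _]cls_sandwich [X in _ = _ - X]cls_sandwich.
(* The classes are now compared as they are, without being computed. *)
move: necklace_der => N.
rewrite 4!big_cons big_nil [LHS]add0r [X in _ + X]add0r [X in _ + X]addr0.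
(* The sign of the letter d/dx: it moves past the odd letter d/dy. *)
have e : ((sdeg degT [:: inl ix]).+1 * sdeg degT [:: inl ix; inr iy] = 1)%N.
  by rewrite !sdeg_cons sdeg_nil.
rewrite /= sdeg_nil muln0 expr0 scale1r.
rewrite [X in (-1) ^+ X]e expr1 scaleN1r.
exact: addrC.
Qed.

Lemma dP_formula (D : algT K -> algT K -> algTT K) f : is_dschouten D ->
  dP D (cls degT tensorP) (incl_cyc (cls degA f)) =
  cls degT (sandwich ix (cycder iy f) - sandwich iy (cycder ix f)).
Proof.
move=> DP; rewrite incl_cycE /dP schouten_cls // (dschouten_unique DP dsch0P).
move: f; apply: (mon_eq (phi := fun f => cm degT (dsch0 tensorP (incl f)))).
- exact: lin_comp incl_lin (lin_comp (dsch_linr _ _ tensorP) (cm_lin degT)).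
- apply: lin_comp (cls_linear degT).
  by apply: lin_sub; exact: lin_comp (cycder_lin _) (sandwich_lin _).
- exact: bracketP_word.
Qed.

Lemma dercoef_sandwich i j a :
  dercoef j (sandwich i a) = (j == i)%:R *: (gen K ix * a * gen K ix).
Proof. exact: dercoef_incl. Qed.

(** The components along d/dx and d/dy are read off by [dercoef] separately, and
    the factors x cancel. *)
Lemma sandwich_eq0 a b : cls degT (sandwich ix a - sandwich iy b) = 0 ->
  a = 0 /\ b = 0.
Proof.
move=> /cls0P h.
have e j : (j == ix)%:R *: (gen K ix * a * gen K ix) -
    (j == iy)%:R *: (gen K ix * b * gen K ix) = 0.
  have := dercoef_scomm j _ h; rewrite -scaleN1r addrC (dercoef_lin j) scaleN1r addrC.
  by rewrite [X in X - _]dercoef_sandwich [X in _ - X]dercoef_sandwich.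
split; apply: (@mul_gen_inj ix).
  by have := e ix; rewrite scale1r scale0r subr0.
by have := e iy; rewrite scale1r scale0r sub0r => /eqP; rewrite oppr_eq0 => /eqP.
Qed.

End Components.

(** * The differential and its kernel in degree zero *)

Theorem proposition19 (K : closedFieldType) (charK : [pchar K] =i pred0)
    (dx dy : algA K -> algAA K)
    (dxP : is_dpartial ix dx) (dyP : is_dpartial iy dy)
    (D : algT K -> algT K -> algTT K) (DP : is_dschouten D) :
  let x : algA K := gen K ix in
  let P : algT K := coordT ix * derT ix * coordT ix * derT iy in
  (forall f : algA K,
     dP D (cls degT P) (incl_cyc (cls degA f)) =
     cls degT (incl (x * mu_op (dy f) * x) * derT ix
               - incl (x * mu_op (dx f) * x) * derT iy)) /\
  (injective (fun c : K => cls degA (c%:A : algA K)) /\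
   forall q : cycA K,
     H0 D (cls degT P) q <-> exists c : K, q = cls degA (c%:A : algA K)).
Proof.
move=> x P; split=> [f|].
  rewrite (dpartial_unique dxP (dpartP ix)) (dpartial_unique dyP (dpartP iy)).
  exact: dP_formula.
split; first exact: cls_scalar_inj.
move=> q; rewrite /H0; split=> [|[c ->]].
  rewrite -[q]repK dP_formula // => /sandwich_eq0[dy0 dx0].
  apply: (euler_const _ charK) => i.
  by case: (letA_cases i) => ->; [exact: dx0|exact: dy0].
rewrite dP_formula // !cycder_scalar !(lin_0 (sandwich_lin _)) subrr.
exact: lin_0 (cls_linear degT).
Qed.
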